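(* Let $\Phi,\Psi\in\{\Gamma,\Omega\}$ and $\star\in\{1,fin\}$. Then for a space $X$ the following statements are equivalent: (1) $X$ satisfies $S_\star(\Phi,\Psi)$; (2) the hyperspace $(2^X,\mathbf{Z}^+)$ satisfies $S_\star(\mathcal{D}_\Phi,\mathcal{D}_\Psi)$.
   Context: Standing assumption: all spaces are Hausdorff and non-compact unless otherwise stated. For a space $X$, $2^X$ is the family of all closed subsets of $X$ (including $\emptyset$). For $A\subseteq X$ put $A^c=X\setminus A$ and $A^+=\{F\in 2^X: F\subseteq A\}$. The $\mathbf{Z}^+$-topology on $2^X$ has base $\{(D^c)^+: D\subseteq X \text{ non-empty finite}\}\cup\{2^X\}$. Covers are non-trivial: $\mathcal{U}$ is a cover of $X$ if $X=\bigcup\mathcal{U}$ and $X\notin\mathcal{U}$. An open cover $\mathcal{U}$ of $X$ is an $\omega$-cover if each finite subset of $X$ is contained in an element of $\mathcal{U}$; it is a $\gamma$-cover if it is infinite and for each finite $C\subseteq X$ the set $\{U\in\mathcal{U}: C\not\subseteq U\}$ is finite. $\Omega$ and $\Gamma$ are the families of all open $\omega$-covers, respectively open $\gamma$-covers, of $X$. Selection principles: $S_1(\mathcal{A},\mathcal{B})$ says that for each sequence $(A_n)_{n\in\mathbb{N}}$ of elements of $\mathcal{A}$ there are $b_n\in A_n$ ($n\in\mathbb{N}$) such that $\{b_n:n\in\mathbb{N}\}\in\mathcal{B}$. $S_{fin}(\mathcal{A},\mathcal{B})$ says that for each sequence $(A_n)_{n\in\mathbb{N}}$ of elements of $\mathcal{A}$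 there are finite sets $B_n\subseteq A_n$ such that $\bigcup_{n\in\mathbb{N}}B_n\in\mathcal{B}$. For $(2^X,\mathbf{Z}^+)$: $\mathcal{D}_\Omega$ is the family of all dense subsets $\mathcal{A}$ of $(2^X,\mathbf{Z}^+)$ with $\emptyset\notin\mathcal{A}$. $\mathcal{D}_\Gamma$ is the family of all infinite $\mathcal{A}\subseteq 2^X$ with $\emptyset\notin\mathcal{A}$ that converge to $\{\emptyset\}$, meaning that for every $F\in 2^X$ and every $\mathbf{Z}^+$-neighborhood $W$ of $F$ the set $\{A\in\mathcal{A}: A\notin W\}$ is finite. *)

(* Defs.v *)
From HB Require Import structures.
From mathcomp Require Import all_boot all_classical topology.

Set Implicit Arguments.
Unset Strict Implicit.
Unset Printing Implicit Defensive.

Local Open Scope classical_set_scope.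

Section SelectionPrinciples.
Variable T : Type.

Definition S_1 (A B : set (set T)) : Prop :=
  forall A_ : nat -> set T, (forall n, A (A_ n)) ->
  exists2 b : nat -> T, (forall n, A_ n (b n)) & B (range b).

Definition S_fin (A B : set (set T)) : Prop :=
  forall A_ : nat -> set T, (forall n, A (A_ n)) ->
  exists2 B_ : nat -> set T,
    (forall n, finite_set (B_ n) /\ B_ n `<=` A_ n) & B (\bigcup_n B_ n).

End SelectionPrinciples.

Inductive selection_kind := sel_1 | sel_fin.

Definition S_ (star : selection_kind) (T : Type) : set (set T) -> set (set T) -> Prop :=
  match star with sel_1 => @S_1 T | sel_fin => @S_fin T end.

Inductive family_kind := Gamma | Omega.

Section Covers.
Variable X : topologicalType.

(* Covers are non-trivial: the whole space is not a member. *)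
Definition open_cover (U : set (set X)) : Prop :=
  [/\ U `<=` open, \bigcup_(V in U) V = [set: X] & ~ U [set: X]].

Definition omega_cover (U : set (set X)) : Prop :=
  open_cover U /\
  forall C : set X, finite_set C -> exists2 V, U V & C `<=` V.

Definition gamma_cover (U : set (set X)) : Prop :=
  [/\ open_cover U, infinite_set U &
   forall C : set X, finite_set C -> finite_set [set V | U V /\ ~ (C `<=` V)]].

Definition cover_family (k : family_kind) : set (set (set X)) :=
  match k with Gamma => gamma_cover | Omega => omega_cover end.

End Covers.

(* A dedicated record, since [set_type] already carries a (subspace) topology. *)
Record hyperspace (X : topologicalType) := Hyperspace {
  hyper_set :> set X;
  hyper_closed : closed hyper_set }.

Lemma hyper_inj (X : topologicalType) : injective (@hyper_set X).
Proof.
move=> [F cF] [G cG] /= FG; move: cF; rewrite FG => cF.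
by rewrite (Prop_irrelevance cF cG).
Qed.

HB.instance Definition _ (X : topologicalType) :=
  gen_eqMixin (hyperspace X).
HB.instance Definition _ (X : topologicalType) :=
  gen_choiceMixin (hyperspace X).

Definition hyper0 (X : topologicalType) : hyperspace X :=
  Hyperspace (@closed0 X).

Section Zplus.
Variable X : topologicalType.

Definition hyper_plus (A : set X) : set (hyperspace X) :=
  [set F : hyperspace X | F `<=` A].

Definition Zplus_base : set (set (hyperspace X)) :=
  [set hyper_plus (~` D) | D in [set D | finite_set D /\ D !=set0]]
    `|` [set setT].

Lemma Zplus_base_cover : \bigcup_(B in Zplus_base) id B = setT.
Proof. by apply/seteqP; split=> // F _; exists setT => //; right. Qed.

Lemma Zplus_base_join (B C : set (hyperspace X)) (F : hyperspace X) :
    Zplus_base B -> Zplus_base C -> id B F -> id C F ->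
  exists E, [/\ Zplus_base E, id E F & id E `<=` id B `&` id C].
Proof.
case=> [[D [finD D0] <-]|->]; last by move=> bC _ CF; exists C; split.
case=> [[E [finE E0] <-]|->]; last first.
  move=> BF _; exists (hyper_plus (~` D)); split=> //.
  by left; exists D.
move=> FD FE; exists (hyper_plus (~` (D `|` E))); split.
- left; exists (D `|` E) => //; split; first by rewrite finite_setU.
  by case: D0 => x Dx; exists x; left.
- by move=> x Fx [/(FD x Fx)|/(FE x Fx)].
- move=> G /= GDE; split=> x Gx.
    by move=> Dx; apply: (GDE x Gx); left.
  by move=> Ex; apply: (GDE x Gx); right.
Qed.

End Zplus.

HB.instance Definition _ (X : topologicalType) :=
  isBaseTopological.Build (hyperspace X)
    (@Zplus_base_cover X) (@Zplus_base_join X).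

Lemma Zplus_openE (X : topologicalType) (O : set (hyperspace X)) :
  open O <-> exists2 B, B `<=` @Zplus_base X & \bigcup_(V in B) V = O.
Proof. by []. Qed.

Section HyperspaceFamilies.
Variable X : topologicalType.

Definition D_Omega (A : set (hyperspace X)) : Prop :=
  dense A /\ ~ A (hyper0 X).

Definition D_Gamma (A : set (hyperspace X)) : Prop :=
  [/\ infinite_set A, ~ A (hyper0 X) &
   (* [A] converges to the singleton {emptyset} *)
   forall (F : hyperspace X) (W : set (hyperspace X)),
     nbhs F W -> finite_set (A `\` W)].

Definition dense_family (k : family_kind) : set (set (hyperspace X)) :=
  match k with Gamma => D_Gamma | Omega => D_Omega end.

End HyperspaceFamilies.

(* Main.v *)
(** Complementation [F |-> X \ F] is a bijection from the closed subsets of [X]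
    onto the open ones.  Since [F] lies in [(D^c)^+] exactly when [D] lies in the
    complement of [F], it carries [D_Omega] onto the omega-covers and [D_Gamma]
    onto the gamma-covers, and selection principles are invariant under such a
    bijection. *)
Require Import Defs.
From mathcomp Require Import all_boot all_classical topology.

Local Open Scope classical_set_scope.

Lemma S_transfer (star : selection_kind) {T T' : Type} (g : T -> T')
    (A B : set (set T)) (A' B' : set (set T')) :
  injective g ->
  (forall S, A S <-> A' (g @` S)) -> (forall S, B S <-> B' (g @` S)) ->
  (forall S, A' S -> S `<=` range g) ->
  S_ star A' B' <-> S_ star A B.
Proof.
move=> g_inj AA' BB' A'g.
have imK S : S `<=` range g -> g @` (g @^-1` S) = S.
  move=> Sg; apply/seteqP; split=> [_ [x Sx <-] //|y Sy].
  by have [x _ gx] := Sg y Sy; exists x; rewrite //= gx.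
have preK S x : (g @` S) (g x) -> S x by case=> y Sy /g_inj <-.
case: star => /=; split=> sel A_ AA_.
- have [b' b'A Bb'] := sel (fun n => g @` A_ n) (fun n => (AA' _).1 (AA_ n)).
  have /choice[b bP] n : exists x, A_ n x /\ g x = b' n.
    by have [x Ax gx] := b'A n; exists x.
  exists b => [n|]; first exact: (bP n).1.
  apply/BB'; suff -> : g @` range b = range b' by [].
  rewrite image_comp; congr (_ @` _); apply: funext => n; exact: (bP n).2.
- have [n|b bA Bb] := sel (fun n => g @^-1` A_ n).
    by apply/AA'; rewrite imK//; exact: A'g.
  by exists (g \o b) => [n|]; [exact: bA | move/BB': Bb; rewrite image_comp].
- have [B'_ B'P BB'_] := sel (fun n => g @` A_ n) (fun n => (AA' _).1 (AA_ n)).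
  exists (fun n => g @^-1` B'_ n) => [n|].
    have [fB' B'A] := B'P n; split; last by move=> x /= /B'A /preK.
    apply: finite_preimage => // x y _ _; exact: g_inj.
  apply/BB'; rewrite image_bigcup.
  suff -> : \bigcup_n (g @` (g @^-1` B'_ n)) = \bigcup_n B'_ n by [].
  apply: eq_bigcupr => n _; apply: imK => y /(B'P n).2[x _ <-]; by exists x.
- have [n|B_ B_P BB_] := sel (fun n => g @^-1` A_ n).
    by apply/AA'; rewrite imK//; exact: A'g.
  exists (fun n => g @` B_ n) => [n|].
    have [fB BA] := B_P n; split; first exact: finite_image.
    by move=> _ [x /BA Ax <-].
  by rewrite -image_bigcup; apply/BB'.
Qed.

Section Complementation.
Variable X : topologicalType.
Implicit Types (F : hyperspace X) (A : set (hyperspace X)).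

Definition hyper_compl F : set X := ~` F.

Lemma hyper_compl_inj : injective hyper_compl.
Proof. by move=> F G /setC_inj /hyper_inj. Qed.

Lemma open_hyper_compl F : open (hyper_compl F).
Proof. exact/closed_openC/hyper_closed. Qed.

Lemma open_sub_range_hyper_compl (U : set (set X)) :
  U `<=` open -> U `<=` range hyper_compl.
Proof.
move=> Uo V /Uo oV; exists (Hyperspace (open_closedC oV)) => //.
exact: setCK.
Qed.

Lemma hyper_compl_setT A : (hyper_compl @` A) setT <-> A (hyper0 X).
Proof.
split=> [[F AF FT]|A0]; last by exists (hyper0 X) => //; exact: setC0.
suff <- : F = hyper0 X by [].
by apply: hyper_compl_inj; rewrite FT; exact/esym/setC0.
Qed.

Lemma hyper_plusCE (C : set X) F : hyper_plus (~` C) F <-> C `<=` hyper_compl F.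
Proof. exact: subsetCPr. Qed.

(** The base uses nonempty [D] only; for empty [C] the set is the whole hyperspace, the extra member
    of the base. This allows arbitrary finite sets, as in the definitions of the covers. *)
Lemma open_hyper_plusC {C : set X} : finite_set C -> open (hyper_plus (~` C)).
Proof.
move=> fC; apply/Zplus_openE; exists [set hyper_plus (~` C)];
  last exact: bigcup_set1.
move=> _ ->; have [->|C0] := eqVneq C set0; last first.
  by left; exists C => //; split=> //; exact/set0P.
by right; rewrite setC0; apply/seteqP; split.
Qed.

Lemma open_hyper_plusP {O : set (hyperspace X)} {F} : open O -> O F ->
  exists C : set X, [/\ finite_set C, hyper_plus (~` C) F & hyper_plus (~` C) `<=` O].
Proof.
move=> /Zplus_openE[B BZ <-] [V BV VF].
have VO : V `<=` \bigcup_(V in B) V by exact: bigcup_sup.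
have [[C [fC _] CV]|VT] := BZ _ BV; first by exists C; rewrite CV.
exists set0; split; [exact: finite_set0 | by rewrite setC0 |].
by move=> G _; apply: VO; rewrite VT.
Qed.

Lemma open_cover_hyper_compl A : ~ A (hyper0 X) ->
  (forall x, exists2 F, A F & [set x] `<=` hyper_compl F) ->
  open_cover (hyper_compl @` A).
Proof.
move=> A0 Ax; split; last by move/hyper_compl_setT.
  by move=> _ [F _ <-]; exact: open_hyper_compl.
apply/seteqP; split=> // x _; have [F AF xF] := Ax x.
by exists (hyper_compl F); [exists F | exact: xF].
Qed.

Lemma D_Omega_hyper_compl A : D_Omega A <-> omega_cover (hyper_compl @` A).
Proof.
split=> [[dA A0]|[[_ _ nT] cov]].
  have cov (C : set X) : finite_set C -> exists2 F, A F & C `<=` hyper_compl F.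
    move=> fC; have [] := dA (hyper_plus (~` C)) _ (open_hyper_plusC fC).
      by exists (hyper0 X) => x [].
    by move=> F [/hyper_plusCE FC AF]; exists F.
  split; last by move=> C /cov[F AF CF]; exists (hyper_compl F) => //; exists F.
  by apply: open_cover_hyper_compl => // x; apply: cov; exact: finite_set1.
split; last by move/hyper_compl_setT.
move=> O [F OF] oO; have [C [fC _ CO]] := open_hyper_plusP oO OF.
have [_ [G AG <-] CG] := cov C fC.
by exists G; split=> //; apply: CO; exact/hyper_plusCE.
Qed.

(** The empty closed set lies in every [hyper_plus (~] C)[, so convergence at that one point already
    yields the gamma condition. Conversely, a neighborhood of any]F[contains some]hyper_plus (~[C)]
    with [C] finite, and few members of [A] miss the latter. *)
Lemma D_Gamma_hyper_compl A : D_Gamma A <-> gamma_cover (hyper_compl @` A).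
Proof.
have badE (C : set X) : [set V | (hyper_compl @` A) V /\ ~ C `<=` V] =
    hyper_compl @` (A `\` hyper_plus (~` C)).
  apply/seteqP; split=> [_ [[F AF <-] nCF]|_ [F [AF nCF] <-]].
    by exists F => //; split=> // /hyper_plusCE.
  by split; [exists F | move=> /hyper_plusCE].
have finE S : finite_set (hyper_compl @` S) <-> finite_set S.
  rewrite (eq_finite_set (inj_card_eq _)) // => F G _ _.
  exact: hyper_compl_inj.
split=> [[infA A0 cvA]|[[_ _ nT] infA cov]].
  have fin (C : set X) : finite_set C -> finite_set (A `\` hyper_plus (~` C)).
    move=> fC; apply: (cvA (hyper0 X)); apply: open_nbhs_nbhs; split.
      exact: open_hyper_plusC.
    by move=> x [].
  split; last by move=> C fC; rewrite badE; apply/finE/fin.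
    apply: open_cover_hyper_compl => // x; apply: contrapT => nF; apply: infA.
    apply: sub_finite_set (fin [set x] (finite_set1 x)) => F AF.
    by split=> // /hyper_plusCE xF; apply: nF; exists F.
  by move/finE.
split; [by move/finE | by move/hyper_compl_setT |].
move=> F W; rewrite nbhsE => -[O [oO OF] OW].
have [C [fC _ CO]] := open_hyper_plusP oO OF.
have /finE : finite_set (hyper_compl @` (A `\` hyper_plus (~` C))).
  by rewrite -badE; exact: cov.
by apply: sub_finite_set; apply: setDS; exact: subset_trans OW.
Qed.

Lemma dense_family_hyper_compl (k : family_kind) A :
  dense_family k A <-> cover_family k (hyper_compl @` A).
Proof. by case: k; [exact: D_Gamma_hyper_compl | exact: D_Omega_hyper_compl]. Qed.

Lemma cover_family_open (k : family_kind) (U : set (set X)) :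
  cover_family k U -> U `<=` open.
Proof. by case: k => [[[]]|[[]]]. Qed.

End Complementation.

Theorem theorem3p1 (Phi Psi : family_kind) (star : selection_kind)
    (X : topologicalType) (hausX : hausdorff_space X)
    (ncX : ~ compact [set: X]) :
  S_ star (@cover_family X Phi) (@cover_family X Psi) <->
  S_ star (@dense_family X Phi) (@dense_family X Psi).
Proof.
apply: (S_transfer star (@hyper_compl X)).
- exact: hyper_compl_inj.
- exact: dense_family_hyper_compl.
- exact: dense_family_hyper_compl.
- move=> U /cover_family_open; exact: open_sub_range_hyper_compl.
Qed.
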